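(* For every positive integer $k$ there exist constants $\epsilon,\alpha>0$ with the following property. Let $G$ be an ordered graph on $n$ vertices with maximum degree at most $\epsilon n$ such that $G$ does not contain a monotone path of size $k$ as an induced ordered subgraph. Then there exist an integer $t\ge 2$ and $t$ pairwise disjoint subsets $X_1,\dots,X_t\subset V(G)$ such that $t\ge \alpha\left(\frac{n}{|X_i|}\right)^{1/2}$ for every $i=1,\dots,t$, and there is no edge of $G$ between $X_i$ and $X_j$ for all $1\le i<j\le t$.
   Context: An ordered graph is a graph together with a total ordering $\prec$ of its vertex set. An ordered graph $H$ is an induced ordered subgraph of an ordered graph $G$ if there is an order-preserving injection $V(H)\to V(G)$ mapping edges to edges and non-edges to non-edges. The monotone path of size $k$ is the ordered graph on vertices $1\prec 2\prec\dots\prec k$ with edges $\{i,i+1\}$ for $i=1,\dots,k-1$.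
   Formalization: The graph is assumed to have n ≥ 2 vertices and the sets X_i are required to be nonempty; for n = 1 and k ≥ 2 the claim as written fails, since a single vertex has no two disjoint nonempty subsets. *)

(* Defs.v *)
From mathcomp Require Import all_boot all_order all_algebra.
From mathcomp Require Import reals.

Set Implicit Arguments.
Unset Strict Implicit.
Unset Printing Implicit Defensive.

Import Order.TTheory.

(* Finite simple graph whose vertex type carries the total order. *)
Record ordered_graph := OrderedGraph {
  og_disp : Order.disp_t;
  og_vertex :> finOrderType og_disp;
  adj : rel og_vertex;
  adj_sym : symmetric adj;
  adj_irr : irreflexive adj }.

Arguments adj {o}.

Definition deg (G : ordered_graph) (x : G) : nat := #|[set y : G | adj x y]|.

Definition max_deg (G : ordered_graph) : nat := \max_(x : G) deg x.

Definition induced_ordered_subgraph (H G : ordered_graph) : Prop :=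
  exists f : H -> G,
    [/\ injective f,
        {homo f : x y / (x <= y)%O}
      & forall x y : H, adj (f x) (f y) = adj x y].

Definition mpath_adj (k : nat) : rel 'I_k :=
  fun i j => (i.+1 == j :> nat) || (j.+1 == i :> nat).

Lemma mpath_adj_sym k : symmetric (@mpath_adj k).
Proof. by move=> i j; rewrite /mpath_adj orbC. Qed.

Lemma mpath_adj_irr k : irreflexive (@mpath_adj k).
Proof. by move=> i; rewrite /mpath_adj orbb gtn_eqF. Qed.

(* Vertices are numbered 0, ..., k - 1 instead of 1, ..., k. *)
Definition monotone_path (k : nat) : ordered_graph :=
  OrderedGraph (@mpath_adj_sym k) (@mpath_adj_irr k).

Definition no_edge_between (G : ordered_graph) (A B : {set G}) : Prop :=
  forall x y : G, x \in A -> y \in B -> ~~ adj x y.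

(* Main.v *)
(* The path is grown one vertex at a time.  Write e for the relation "adjacent
   and smaller".  A stage consists of sources A, each the end of an induced
   monotone path, and targets T, non-adjacent to these paths except possibly to
   their ends, such that each target has a source below it and all forward
   degrees into T are at most D, where |T|^2 / (n D) is at least a large
   constant.  To extend the paths, pass to a minimal S in T keeping this ratio,
   so that every half of S still receives a degree of order D.  Greedily choose
   roots C covering a constant fraction U of S by sets of size of order D, so
   that the number of roots below a typical point of U is bounded.  If the roots
   lie in T rather than in A, prolong the paths to them and delete the forward
   neighbourhoods of the former ends, which are then negligible.  If most edges
   x < y inside U had all roots of x adjacent to y, then classes of points with
   equal root sets would be anticomplete, and merging them into groups of size D
   would give the desired family.  Otherwise a random splitting of C produces
   new sources (above the first part) and targets (avoiding the first part). *)
Require Import Defs.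
From mathcomp Require Import all_boot all_order all_algebra.
From mathcomp Require Import reals.
From mathcomp Require Import zify.

Set Implicit Arguments.
Unset Strict Implicit.
Unset Printing Implicit Defensive.

Import Order.TTheory GRing.Theory Num.Theory.

(** * Merging classes, random splitting and greedy covers *)

Section Separation.
Variables (V : finType) (e : rel V).
Implicit Types (x y z : V) (S T U A C R : {set V}).

(** Squared, division-free form of [t >= sqrt (n / #|X i|)]. Both orders of [i] and [j] are covered
    because [e] is directed. *)
Definition separated (n : nat) : Prop :=
  exists (t : nat) (X : 'I_t -> {set V}),
    [/\ 2 <= t,
        forall i, n <= t ^ 2 * #|X i|,
        forall i j, i != j -> [disjoint X i & X j]
      & forall i j, i != j -> {in X i & X j, forall x y, ~~ e x y}].

(** Edges stay inside classes of [f], so a minimal union [W] of classes with at least [D] points can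
    be split off; dropping one class from it shows [#|W| <= 2 * D]. *)
Lemma merge_classes (I : eqType) (f : V -> I) D t S :
  0 < D ->
  {in S &, forall x y, e x y -> f x = f y} ->
  {in S, forall x, #|[set y in S | f y == f x]| <= D} ->
  2 * D * t <= #|S| ->
  exists X : nat -> {set V},
    [/\ forall i, i < t -> X i \subset S /\ D <= #|X i|
      & forall i j, i < j < t ->
          [/\ [disjoint X i & X j],
              {in X i & X j, forall x y, ~~ e x y}
            & {in X j & X i, forall x y, ~~ e x y}]].
Proof.
move=> D0; elim: t S => [|t IH] S fS dS cS.
  by exists (fun=> set0); split=> // i j; rewrite ltn0 andbF.
pose P (W : {set V}) := [&& W \subset S, D <= #|W| &
  [forall x in W, forall y in S, (f y == f x) ==> (y \in W)]].
have PS : P S.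
  rewrite /P subxx /=; apply/andP; split.
    by apply: leq_trans cS; rewrite mulnS; lia.
  by apply/forall_inP=> x _; apply/forall_inP=> y ->; rewrite implybT.
have [W /minsetP[/and3P[WS DW /forall_inP satW] minW] _] := minset_exists PS.
have {}satW x y : x \in W -> y \in S -> f y = f x -> y \in W.
  by move=> xW yS /eqP fyx; move/forall_inP: (satW x xW) => /(_ y yS); rewrite fyx.
have [x xW] : exists x, x \in W by apply/set0Pn; rewrite -card_gt0; lia.
have W2 : #|W| <= 2 * D.
  pose Cx := [set y in S | f y == f x].
  have CW : Cx \subset W.
    by apply/subsetP=> y; rewrite inE => /andP[yS /eqP]; exact: satW.
  have Cc : #|Cx| <= D by apply: dS; apply: (subsetP WS).
  have xC : x \in Cx by rewrite inE eqxx (subsetP WS).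
  have cWC := cardsD W Cx; rewrite (setIidPr CW) in cWC.
  rewrite leqNgt; apply/negP => W2.
  have PW : P (W :\: Cx).
    apply/and3P; split; first exact: subset_trans (subsetDl _ _) WS.
      by lia.
    apply/forall_inP=> u /setDP[uW uC]; apply/forall_inP=> v vS.
    apply/implyP=> /eqP fvu; rewrite inE (satW u) // andbT.
    by apply: contra uC; rewrite !inE -fvu vS (subsetP WS _ uW).
  have := minW _ PW (subsetDl _ _).
  by move/setP/(_ x); rewrite !inE xW (subsetP WS _ xW) eqxx.
have [|||X [X1 X2]] := IH (S :\: W).
- by move=> u v /setDP[uS _] /setDP[vS _]; apply: fS.
- move=> u /setDP[uS _]; apply: leq_trans (dS u uS); apply: subset_leq_card.
  by apply/subsetP=> v; rewrite !inE => /andP[/andP[_ ->] ->].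
- by rewrite cardsD (setIidPr WS); rewrite mulnS in cS; lia.
exists (fun i => if i is i'.+1 then X i' else W); split.
  move=> [|i] // /X1[XS DX]; split=> //.
  exact: subset_trans XS (subsetDl _ _).
move=> [|i] [|j] //=; rewrite ?ltnS; last exact: X2.
case/X1 => XS _; split.
  rewrite disjoint_sym disjoint_subset; apply/subsetP=> u /(subsetP XS) /setDP[_].
  by rewrite inE.
  move=> u v uW /(subsetP XS) /setDP[vS vW]; apply: contra vW => uv.
  by apply: (satW u) => //; apply/esym/fS => //; apply: (subsetP WS).
move=> u v /(subsetP XS) /setDP[uS uW] vW; apply: contra uW => uv.
by apply: (satW v) => //; apply: fS => //; apply: (subsetP WS).
Qed.

(** For [t = #|S| %/ (2 * D)] one has [#|S| <= 4 * D * t]; squaring yields [n <= t ^ 2 * D]. *)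
Lemma large_classes_separated (I : eqType) (f : V -> I) D n S :
  0 < D -> D <= n ->
  {in S &, forall x y, e x y -> f x = f y} ->
  {in S, forall x, #|[set y in S | f y == f x]| <= D} ->
  16 * n * D <= #|S| ^ 2 -> separated n.
Proof.
move=> D0 Dn fS dS cS.
have S4 : 4 * D <= #|S| by nia.
pose t := #|S| %/ (2 * D).
have t1 : 2 * D * t <= #|S| by rewrite mulnC leq_trunc_div.
have t2 : #|S| < 2 * D * t.+1 by rewrite mulnC -ltn_divLR //; lia.
have t_ge2 : 2 <= t by nia.
have [X [X1 X2]] := merge_classes D0 fS dS t1.
exists t, X; split=> // [i|i j ij|i j ij].
- have [_ DX] := X1 i (ltn_ord i).
  have h : #|S| <= 4 * D * t by nia.
  have : #|S| ^ 2 <= (4 * D * t) ^ 2 by rewrite leq_exp2r.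
  have : D * t ^ 2 <= t ^ 2 * #|X i| by nia.
  nia.
- have [ij'|ij'|/val_inj eij] := ltngtP i j; last by rewrite eij eqxx in ij.
    by case: (X2 i j) => //; rewrite ij' ltn_ord.
  by rewrite disjoint_sym; case: (X2 j i) => //; rewrite ij' ltn_ord.
- have [ij'|ij'|/val_inj eij] := ltngtP i j; last by rewrite eij eqxx in ij.
    by case: (X2 i j) => //; rewrite ij' ltn_ord.
  by case: (X2 j i) => //; rewrite ij' ltn_ord.
Qed.

(* Averaging over a uniformly random C1 \subset C: each y survives with
   probability at least 1 / 2 ^ q.+1. *)
Lemma random_split (C Y : {set V}) (v : V -> V) (N : V -> {set V}) q :
  {in Y, forall y, [/\ v y \in C, v y \notin N y & #|N y| <= q]} ->
  exists C1 : {set V}, C1 \subset C /\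
    #|Y| <= 2 ^ q.+1 * #|[set y in Y | (v y \in C1) && [disjoint C1 & N y]]|.
Proof.
move=> hY; pose good C1 := [set y in Y | (v y \in C1) && [disjoint C1 & N y]].
suff /exists_inP[C1] : [exists C1 in powerset C, #|Y| <= 2 ^ q.+1 * #|good C1|].
  by rewrite inE => C1C hC1; exists C1.
apply: contraT; rewrite negb_exists_in => /forall_inP hlt.
have h1 : 2 ^ q.+1 * \sum_(C1 in powerset C) #|good C1| < 2 ^ #|C| * #|Y|.
  rewrite big_distrr /= -card_powerset -sum_nat_const.
  (* The term of [set0] keeps the summed inequality strict. *)
  have lt0 : set0 \in powerset C by rewrite inE sub0set.
  rewrite (bigD1 set0) //= [X in _ < X](bigD1 set0) //=.
  rewrite -addSn leq_add //; first by rewrite ltnNge hlt.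
  by apply: leq_sum => i /andP[/hlt]; rewrite -ltnNge => /ltnW.
suff h2 : 2 ^ #|C| * #|Y| <= 2 ^ q.+1 * \sum_(C1 in powerset C) #|good C1|.
  by rewrite ltnNge h2 in h1.
have -> : \sum_(C1 in powerset C) #|good C1| =
  \sum_(y in Y) #|[set C1 in powerset C | (v y \in C1) && [disjoint C1 & N y]]|.
  under eq_bigr => C1 _ do rewrite -sum1_card big_mkcond.
  rewrite exchange_big /= [RHS]big_mkcond /=; apply: eq_bigr => y _.
  case: ifP => yY; last by apply: big1 => C1 _; rewrite inE yY.
  rewrite -sum1_card -big_mkcondr /=; apply: eq_bigl => C1.
  by rewrite !inE yY.
rewrite mulnC -sum_nat_const big_distrr; apply: leq_sum => y /hY[vC vN Nq].
set F := [set C1 in _ | _].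
(* Each [v y |: B] with [B \subset E] keeps [y], and [E] misses at most [q + 1] points of [C]. *)
pose E := (C :\: N y) :\ v y.
have : [set v y |: B | B in powerset E] \subset F.
  apply/subsetP=> Z /imsetP[B]; rewrite inE => /subsetP BE {Z}->.
  rewrite !inE eqxx /=; apply/andP; split.
    apply/subsetP=> z /setU1P[->//|/BE]; by rewrite !inE => /and3P[].
  rewrite disjoint_subset; apply/subsetP=> z /setU1P[->//|/BE].
  by rewrite !inE => /and3P[].
move/subset_leq_card; rewrite card_in_imset ?card_powerset; last first.
  move=> B1 B2; rewrite !inE => /subsetP B1E /subsetP B2E /setP eB.
  apply/setP=> z; have := eB z; rewrite !inE.
  have [->|//] := eqVneq z (v y) => _.
  have nE : v y \notin E by rewrite !inE eqxx.
  have nB B : {subset B <= E} -> v y \in B = false.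
    by move=> BE; apply: contraNF nE; apply: BE.
  by rewrite !nB.
move=> cF; apply: leq_trans (leq_mul (leqnn (2 ^ q.+1)) cF); rewrite -expnD.
rewrite leq_exp2l //.
have := cardsD1 (v y) (C :\: N y); rewrite inE vC vN /= -/E.
have := cardsD C (N y); have := subset_leq_card (subsetIr C (N y)). lia.
Qed.

(** A maximal [C] with [#|C| * d <= #|U|] works: a root with [d] uncovered forward neighbours could
    still be added. *)
Lemma greedy_cover (B S : {set V}) d : 0 < d ->
  exists C : {set V}, exists U : {set V},
    [/\ C \subset B, U \subset S,
        U = [set y in S | [exists x in C, e x y]],
        #|C| * d <= #|U|
      & {in B, forall x, #|[set y in S :\: U | e x y]| < d}].
Proof.
move=> d0; pose U C := [set y in S | [exists x in C, e x y]].
pose P C := (C \subset B) && (#|C| * d <= #|U C|).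
have P0 : P set0 by rewrite /P sub0set cards0.
have [C /maxsetP[/andP[CB dC] maxC] _] := maxset_exists P0.
exists C, (U C); split=> //; first by apply/subsetP=> y; rewrite inE => /andP[].
move=> x xB; rewrite ltnNge; apply/negP; set F := [set _ in _ | _] => dF.
have xC : x \notin C.
  apply: contraTN dF => xC; rewrite -ltnNge.
  suff -> : F = set0 by rewrite cards0.
  apply/setP=> y; rewrite !inE; apply/negP => /andP[/andP[yU yS] exy].
  by move: yU; rewrite yS /= => /exists_inP[]; exists x.
have dj : [disjoint U C & F].
  rewrite disjoint_subset; apply/subsetP=> y yU.
  by move: yU; rewrite !inE => ->.
have UU : U C :|: F \subset U (x |: C).
  apply/subsetP=> y /setUP[]; rewrite !inE.
    case/andP=> -> /exists_inP[u uC euy]; apply/exists_inP; exists u => //.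
    by rewrite inE uC orbT.
  case/andP=> /andP[_ ->] exy; apply/exists_inP; exists x => //.
  by rewrite inE set11.
have := subset_leq_card UU; rewrite cardsU (disjoint_setI0 dj) cards0 subn0 => cU.
have PxC : P (x |: C).
  rewrite /P subUset sub1set xB CB /= cardsU1 xC; nia.
have := maxC _ PxC (subsetUr _ _) => /setP/(_ x).
by rewrite setU11 (negPf xC).
Qed.


(** * Forward degrees, stages and regular target sets *)

Definition fdeg x S := #|[set y in S | e x y]|.

Lemma fdegS x S T : S \subset T -> fdeg x S <= fdeg x T.
Proof.
move=> ST; apply: subset_leq_card; apply/subsetP=> y; rewrite !inE.
by case/andP=> /(subsetP ST) -> ->.
Qed.

(* The path is listed from its last vertex down to its first. *)
Fixpoint ipath (s : seq V) : bool :=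
  if s is x :: s' then
    (if s' is y :: r then e y x && all (fun z => ~~ e z x) r else true)
    && ipath s'
  else true.

(** Only [s], the part of the path before its end [x], must miss [T], so that the path may continue
    from [x] into [T]. *)
Definition rooted l x T : Prop :=
  exists s, [/\ l <= (size s).+1, ipath (x :: s)
    & {in s & T, forall z y, ~~ e z y}].

Lemma rooted_extend l v x T U :
  rooted l v U -> e v x -> x \in U -> T \subset U ->
  {in T, forall y, ~~ e v y} -> rooted l.+1 x T.
Proof.
case=> s [ls ps sU] vx xU TU vT; exists (v :: s); split=> //.
  rewrite /ipath -/(ipath (v :: s)) vx ps andbT /=.
  by apply/allP=> z zs; apply: sU.
move=> z y; rewrite inE => /orP[/eqP->|zs] yT; first exact: vT.
by apply: sU => //; apply: (subsetP TU).
Qed.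

Lemma rootedW l x T : rooted l.+1 x T -> rooted l x T.
Proof. by case=> s [/ltnW ls ps sT]; exists s. Qed.

Lemma rootedS l x T U : U \subset T -> rooted l x T -> rooted l x U.
Proof.
move=> UT [s [ls ps sT]]; exists s; split=> // z y zs /(subsetP UT).
exact: sT.
Qed.

Definition stage l M : Prop :=
  exists A T D,
    [/\ T != set0, {in T, forall y, exists2 x, x \in A & e x y},
        {in A, forall x, rooted l x T},
        {in A :|: T, forall x, fdeg x T <= D}
      & M * D <= #|T| ^ 2].

(* The weight 8 makes forward neighbourhoods of A negligible against those of T
   whenever the latter realize the maximum. *)
Definition wdeg A T S :=
  maxn (8 * \max_(a in A) fdeg a S) (\max_(y in T) fdeg y S).

Lemma wdeg_leP A T S d :
  reflect ({in A, forall a, 8 * fdeg a S <= d} /\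
           {in T, forall y, fdeg y S <= d}) (wdeg A T S <= d).
Proof.
rewrite geq_max; apply: (iffP andP) => -[hA hT]; split.
- move=> a aA; apply: leq_trans hA; rewrite leq_mul2l /=.
  exact: (leq_bigmax_cond (F := fun a => fdeg a S)).
- exact/bigmax_leqP.
- have /bigmax_leqP h : {in A, forall a, fdeg a S <= d %/ 8}.
    by move=> a /hA; lia.
  by apply: leq_trans (leq_mul (leqnn 8) h) _; lia.
- exact/bigmax_leqP.
Qed.

(** In a minimal [S], a half [R] of at most a quarter of the weight would satisfy the same bound,
    against minimality. *)
Lemma wdeg_regular A T M :
  T != set0 -> M * wdeg A T T <= #|T| ^ 2 ->
  exists S, [/\ S \subset T, S != set0, M * wdeg A T S <= #|S| ^ 2
    & forall R, 0 < wdeg A T S -> R \subset S -> #|S| <= 2 * #|R| ->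
        wdeg A T S < 4 * wdeg A T R].
Proof.
move=> T0 hT; pose P S := (S != set0) && (M * wdeg A T S <= #|S| ^ 2).
have PT : P T by rewrite /P T0.
have [S /minsetP[/andP[S0 hS] minS] ST] := minset_exists PT.
exists S; split=> // R w0 RS cR; rewrite ltnNge; apply/negP => wR.
have PR : P R.
  have S_gt0 : 0 < #|S| by rewrite card_gt0.
  rewrite /P -card_gt0; apply/andP; split; first by lia.
  have : #|S| ^ 2 <= (2 * #|R|) ^ 2 by rewrite leq_exp2r.
  rewrite expnMn => h; have : M * (4 * wdeg A T R) <= M * wdeg A T S.
    by rewrite leq_mul2l wR orbT.
  lia.
have eRS := minS _ PR RS; rewrite eRS in wR; lia.
Qed.

(** * One extension step, through combs of roots and covered points *)

Lemma card_bigcup_le (B : {set V}) (F : V -> {set V}) :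
  #|\bigcup_(v in B) F v| <= \sum_(v in B) #|F v|.
Proof.
elim/big_rec2: _ => [|v m U _ IH]; first by rewrite cards0.
by apply: leq_trans (leq_card_setU _ _) _; rewrite leq_add2l.
Qed.

(** Intermediate between two stages: roots [C] and covered points [U], with at most 8 roots per
    point on average. *)
Definition comb l M : Prop :=
  exists C U D,
    [/\ [/\ 0 < D, U != set0 & M * D <= 64 * #|U| ^ 2],
        {in U, forall u, exists2 v, v \in C & e v u},
        \sum_(v in C) fdeg v U <= 8 * #|U|,
        {in C, forall v, rooted l v U}
      & {in C :|: U, forall v, fdeg v U <= D}].

(** Roots are taken in [A] if these cover a quarter of [S], otherwise in [T]; if both failed, the
    uncovered half of [S] would have weight at most [D %/ 4]. *)
Lemma stage_comb l M : stage l (8 * M) -> comb l M.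
Proof.
case=> A [T [D0 [T0 TA rA degT MT]]].
have hT : M * wdeg A T T <= #|T| ^ 2.
  have wT : wdeg A T T <= 8 * D0.
    apply/wdeg_leP; split=> [a aA|y yT].
      by rewrite leq_mul2l degT ?inE ?aA.
    by apply: leq_trans (degT y _) _; rewrite ?inE ?yT ?orbT //; lia.
  by have := leq_mul (leqnn M) wT; lia.
have [S [ST S0 MS regS]] := wdeg_regular T0 hT.
move: regS MS; set D := wdeg A T S => regS MS.
have /wdeg_leP[dA dT] : wdeg A T S <= D by [].
have D_gt0 : 0 < D.
  have [y yS] := set0Pn _ S0; have [x xA xy] := TA y (subsetP ST _ yS).
  have := dA x xA; suff : 0 < fdeg x S by lia.
  by apply/card_gt0P; exists y; rewrite inE yS.
have S_gt0 : 0 < #|S| by rewrite card_gt0.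
(* Either case below keeps an eighth of [S], whence the factor [64]. *)
have {MT hT MS} MU U : #|S| <= 8 * #|U| -> M * D <= 64 * #|U| ^ 2.
  move=> SU; apply: leq_trans MS _.
  by rewrite -[64]/(8 ^ 2) -expnMn leq_exp2r.
(* Degrees left to [A] are at most [D %/ 32], hence at most [D %/ 4] after weighting by 8. *)
have [CA [UA [CAA UAS UAE cA maxA]]] := greedy_cover A S (ltn0Sn (D %/ 32)).
have [big_A|small_A] := leqP #|S| (4 * #|UA|).
  exists CA, UA, D; split=> [|u|||v].
  - clear - S_gt0 D_gt0 big_A MU; split=> //; first by rewrite -card_gt0; lia.
    by apply: MU; lia.
  - by rewrite UAE inE => /andP[_ /exists_inP].
  - have : \sum_(v in CA) 8 * fdeg v UA <= #|CA| * D.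
      rewrite -sum_nat_const; apply: leq_sum => v vC.
      apply: leq_trans (dA v (subsetP CAA v vC)).
      by rewrite leq_mul2l fdegS.
    rewrite -big_distrr /=.
    have : #|CA| * D <= 32 * (#|CA| * (D %/ 32).+1).
      by rewrite mulnCA leq_mul2l ltnW ?orbT // mulnC ltn_ceil.
    by clear - cA; lia.
  - move=> v /(subsetP CAA) /rA; apply: rootedS.
    exact: subset_trans UAS ST.
  - move=> vCU; apply: leq_trans (fdegS v UAS) _.
    case/setUP: vCU => [/(subsetP CAA)/dA|/(subsetP UAS)/(subsetP ST)]; [|exact: dT].
    by apply: leq_trans; apply: leq_pmull.
have [CT [UT [CTT UTS UTE cT maxT]]] :=
  greedy_cover T (S :\: UA) (ltn0Sn (D %/ 4)).
have UTS' : UT \subset S := subset_trans UTS (subsetDl _ _).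
have big_T : #|S| <= 4 * #|UT|.
  rewrite leqNgt; apply/negP => small_T.
  pose R := (S :\: UA) :\: UT.
  have cR : #|S| <= 2 * #|R|.
    rewrite !cardsD (setIidPr UAS) (setIidPr UTS).
    by clear - small_A small_T; lia.
  have RS : R \subset S by rewrite !(subset_trans (subsetDl _ _)).
  have := regS R D_gt0 RS cR; rewrite ltnNge => /negP; apply.
  suff wR : wdeg A T R <= D %/ 4 by rewrite mulnC -leq_divRL.
  apply/wdeg_leP; split=> [a aA|y yT]; last by have := maxT y yT; rewrite ltnS.
  have := maxA a aA; rewrite ltnS -/(fdeg _ _) => h.
  have {h} := leq_trans (fdegS a (subsetDl (S :\: UA) UT)) h.
  by rewrite -/R; clear; lia.
pose px y := odflt y [pick x in A | e x y].
have pxP y : y \in T -> px y \in A /\ e (px y) y.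
  move=> yT; rewrite /px; case: pickP => [x /andP[]//|no].
  by have [x xA xy] := TA y yT; have := no x; rewrite xA xy.
(* Forward neighbourhoods of the former path ends; by the weight 8, [#|W|] is at most half of
   [#|UT|]. *)
pose W := \bigcup_(y in CT) [set z in S | e (px y) z].
have CTD : #|CT| * D <= 4 * #|UT|.
  have : #|CT| * D <= 4 * (#|CT| * (D %/ 4).+1).
    by rewrite mulnCA leq_mul2l ltnW ?orbT // mulnC ltn_ceil.
  by clear - cT; lia.
have cW : 8 * #|W| <= 4 * #|UT|.
  apply: leq_trans CTD.
  have := card_bigcup_le CT (fun y => [set z in S | e (px y) z]).
  rewrite -/W -(leq_pmul2l (ltn0Sn 7)) => h; apply: leq_trans h _.
  rewrite big_distrr -sum_nat_const; apply: leq_sum => y /(subsetP CTT) yT.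
  by have [pA _] := pxP y yT; exact: dA.
pose U := UT :\: W.
have cU : #|UT| <= 2 * #|U|.
  have := cardsD UT W; rewrite -/U; have := subset_leq_card (subsetIr UT W).
  by clear - cW; lia.
have UUT : U \subset UT := subsetDl _ _.
have US : U \subset S := subset_trans UUT UTS'.
exists CT, U, D; split=> [|u|||v].
- clear - S_gt0 D_gt0 big_T cU MU; split=> //; first by rewrite -card_gt0; lia.
  by apply: MU; lia.
- by move/(subsetP UUT); rewrite UTE inE => /andP[_ /exists_inP].
- have : \sum_(v in CT) fdeg v U <= #|CT| * D.
    rewrite -sum_nat_const; apply: leq_sum => v vC.
    by apply: leq_trans (fdegS v US) (dT v (subsetP CTT v vC)).
  by clear - CTD cU; lia.
- move=> y yC; have yT := subsetP CTT _ yC; have [pA py] := pxP y yT.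
  (* The prolonged path is one vertex longer than claimed; the length is weakened to agree with the
     first case. *)
  apply: rootedW; apply: (rooted_extend (rA _ pA)) => //.
    exact: subset_trans US ST.
  move=> z /setDP[zUT zW]; apply: contra zW => pz; apply/bigcupP; exists y => //.
  by rewrite inE (subsetP UTS').
- move=> vCU; apply: leq_trans (fdegS v US) _; apply: dT.
  by case/setUP: vCU => [/(subsetP CTT)//|/(subsetP US)/(subsetP ST)].
Qed.

(** Along edges from [U1] into [Z] root sets only grow, so between points of [Z] with equally many
    roots they are constant: a large [Z] gives a separated family. Otherwise many [y] have an
    in-neighbour with a root not below [y], and splitting the roots extends the paths. *)
Lemma comb_stage l M Q :
  2 ^ 17 <= Q -> #|V| <= M -> comb l (1024 * Q ^ 2 * M) ->
  separated #|V| \/ stage l.+1 M.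
Proof.
move=> hQ VM [C [U [D [[D0 U0 MD] UC sumC rC degU]]]].
have Q68 : 68 <= Q by apply: leq_trans hQ; apply: (@leq_trans (2 ^ 7)); rewrite ?leq_exp2l.
pose N u := [set v in C | e v u].
pose U1 := [set u in U | #|N u| <= 16].
have U1U : U1 \subset U by apply/subsetP=> u; rewrite inE => /andP[].
have cU1 : #|U| <= 2 * #|U1|.
  have sumN : \sum_(u in U) #|N u| <= 8 * #|U|.
    apply: leq_trans sumC; apply: eq_leq.
    under eq_bigr => u _ do rewrite -sum1_card big_mkcond.
    rewrite exchange_big [RHS]big_mkcond /=; apply: eq_bigr => v _.
    case: ifP => vC; last by apply: big1 => u _; rewrite inE vC.
    rewrite /fdeg -sum1_card -big_mkcondr /=; apply: eq_bigl => u.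
    by rewrite !inE vC.
  (* Points outside [U1] have at least 17 roots, against an average of at most 8. *)
  have : 17 * #|U :\: U1| <= \sum_(u in U) #|N u|.
    rewrite (big_setID U1) /=; apply: leq_trans (leq_addl _ _).
    rewrite mulnC -sum_nat_const; apply: leq_sum => u; rewrite !inE.
    by case/andP=> + uU; rewrite uU /= -ltnNge.
  by rewrite cardsD (setIidPr U1U); have := subset_leq_card U1U; lia.
pose Z := [set y in U1 | [forall x in U1, e x y ==> (N x \subset N y)]].
have ZU1 : Z \subset U1 by apply/subsetP=> u; rewrite inE => /andP[].
have UV : #|U| <= #|V| := max_card _.
have U_gt0 : 0 < #|U| by rewrite card_gt0.
have [big_Z|small_Z] := leqP #|U1| (2 * #|Z|).
  left; pose Zj (j : 'I_17) := [set y in Z | #|N y| == j].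
  have [j cZj] : exists j, #|Z| <= 17 * #|Zj j|.
    apply/existsP; apply: contraT; rewrite negb_exists => /forallP h.
    have : \sum_(j < 17) 17 * #|Zj j| < 17 * #|Z|.
      rewrite -[X in X * #|Z|]card_ord -sum_nat_const big_ord_recl.
      rewrite [X in _ < X]big_ord_recl -addSn leq_add //.
        by rewrite ltnNge h.
      by apply: leq_sum => i _; apply: ltnW; rewrite ltnNge h.
    rewrite -big_distrr ltn_pmul2l // ltnNge => /negP[].
    apply: leq_trans (_ : #|\bigcup_(j < 17) Zj j| <= _).
      apply: subset_leq_card; apply/subsetP=> y yZ; apply/bigcupP.
      have : y \in U1 := subsetP ZU1 y yZ.
      rewrite inE => /andP[_ Ny]; exists (Ordinal (Ny : #|N y| < 17)) => //.
      by rewrite inE yZ /=.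
    elim/big_rec2: _ => [|i m B _ IH]; first by rewrite cards0.
    by apply: leq_trans (leq_card_setU _ _) _; rewrite leq_add2l.
  have ZjU : Zj j \subset U.
    by apply/subsetP=> y; rewrite inE => /andP[/(subsetP ZU1)/(subsetP U1U)].
  (* [68 = 2 * 2 * 17]: the losses in passing to [U1], to [Z] and to one of 17 root counts. *)
  have UZj : #|U| <= 68 * #|Zj j| by lia.
  have U2 : #|U| ^ 2 <= (68 * #|Zj j|) ^ 2 by rewrite leq_exp2r.
  have Q2 : 68 ^ 2 * #|V| <= Q ^ 2 * M by apply: leq_mul => //; rewrite leq_exp2r.
  have key : 16 * #|V| * D <= #|Zj j| ^ 2.
    have := leq_mul Q2 (leqnn D); rewrite expnMn in U2; lia.
  have DV : D <= #|V|.
    have : #|Zj j| ^ 2 <= #|V| ^ 2 by rewrite leq_exp2r // max_card.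
    nia.
  apply: (large_classes_separated (f := N) D0 DV _ _ key).
    move=> x y; rewrite inE => /andP[/(subsetP ZU1) xU1 /eqP cx].
    rewrite !inE => /andP[/andP[_ /forall_inP hy] /eqP cy] exy.
    apply/eqP; rewrite eqEcard cx cy leqnn andbT.
    by move/implyP: (hy x xU1); apply.
  (* A class shares a root [v], so it lies in one forward neighbourhood, of size at most [D]. *)
  move=> x xZ; have [v vC vx] := UC x (subsetP ZjU _ xZ).
  apply: leq_trans (degU v _); last by rewrite inE vC.
  apply: subset_leq_card; apply/subsetP=> y; rewrite in_set.
  case/andP=> /(subsetP ZjU) yU /eqP/setP/(_ v); rewrite !inE vC vx yU /=.
  by move->.
right; pose Y := U1 :\: Z.
have cY : #|U1| <= 2 * #|Y| by rewrite cardsD (setIidPr ZU1); lia.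
pose bad y v := [exists x in U1, e x y && (v \in N x)] && (v \notin N y).
pose vf y := odflt y [pick v | bad y v].
have vfP y : y \in Y -> bad y (vf y).
  case/setDP=> yU1; rewrite inE yU1 /= => /forall_inPn[x xU1].
  rewrite negb_imply => /andP[exy /subsetPn[v vx vy]].
  rewrite /vf; case: pickP => //= /(_ v); rewrite /bad vy andbT => /negbT/negP[].
  by apply/exists_inP; exists x; rewrite ?exy.
(* Points of [U1] have at most 16 roots; the resulting loss [2 ^ 17] is absorbed by [Q]. *)
have [|C1 [C1C cT]] := @random_split C Y vf N 16.
  move=> y yY; have := vfP y yY.
  rewrite /bad => /andP[/exists_inP[x _ /andP[_]]].
  rewrite inE => /andP[vC _] vN; split=> //.
  by case/setDP: yY; rewrite inE => /andP[].
set T := [set y in Y | _] in cT.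
have {}cT : #|Y| <= Q * #|T| by apply: leq_trans cT _; rewrite leq_mul2r hQ orbT.
have TU1 : T \subset U1 by apply/subsetP=> y; rewrite inE => /andP[/setDP[]].
have TU : T \subset U := subset_trans TU1 U1U.
have TN y : y \in T -> {in C1, forall v, ~~ e v y}.
  rewrite inE => /and3P[_ _ dj] v vC1; apply/negP => evy.
  by move/pred0P/(_ v): dj; rewrite /= vC1 inE (subsetP C1C) // evy.
clear hQ; exists [set x in U1 | [exists v in C1, e v x]], T, D; split.
- by rewrite -card_gt0; nia.
- move=> y yT; have := yT; rewrite inE => /and3P[yY vC1 _].
  have := vfP y yY; rewrite /bad => /andP[/exists_inP[x xU1 /andP[exy]]].
  rewrite inE => /andP[_ vx] _; exists x => //; rewrite inE xU1.
  by apply/exists_inP; exists (vf y).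
- move=> x; rewrite inE => /andP[xU1 /exists_inP[v vC1 vx]].
  apply: (rooted_extend (rC v (subsetP C1C _ vC1)) vx) => //.
    exact: subsetP U1U _ xU1.
  by move=> y yT; apply: TN.
- move=> x xAT; apply: leq_trans (fdegS x TU) (degU x _).
  rewrite inE; apply/orP; right; apply: (subsetP U1U).
  by case/setUP: xAT => [|/(subsetP TU1)//]; rewrite inE => /andP[].
(* Squaring [#|U| <= 4 * Q * #|T|] costs [16 * Q ^ 2]; with the [64] of [comb] this is
   [1024 * Q ^ 2]. *)
- have : #|U| ^ 2 <= (4 * (Q * #|T|)) ^ 2 by rewrite leq_exp2r //; lia.
  rewrite !expnMn => h.
  have Q0 : 0 < 1024 * Q ^ 2 by rewrite muln_gt0 expn_gt0; lia.
  rewrite -(leq_pmul2l Q0); lia.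
Qed.

(** * Iteration and the initial stage *)

Lemma stage_iter b k l :
  (forall j M, #|V| <= M -> stage j (b * M) -> separated #|V| \/ stage j.+1 M) ->
  0 < b -> stage l (b ^ k * #|V|) -> separated #|V| \/ stage (l + k) #|V|.
Proof.
move=> step b0; elim: k l => [|k IH] l; first by rewrite mul1n addn0; right.
rewrite expnS -mulnA => /step[|sep|]; last by rewrite addnS -addSn; apply: IH.
  by rewrite leq_pmull // expn_gt0 b0.
by left.
Qed.

(** The targets are the vertices with an in-neighbour; if they are fewer than half, the others form
    a large independent set. *)
Lemma stage_init M d :
  16 <= M -> 2 <= #|V| -> (forall x, fdeg x setT <= d) -> 4 * M * d <= #|V| ->
  separated #|V| \/ stage 1 (M * #|V|).
Proof.
move=> M16 V2 degV Md; have [d0|d_gt0] := posnP d.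
  (* Without edges all singletons serve; the bound [64 <= #|V|] used below needs [0 < d]. *)
  left; exists #|V|, (fun i => [set enum_val i]); split=> // [i|i j ij|i j _ x y _ _].
  - by rewrite cards1 muln1 leq_pmull // (ltnW V2).
  - by rewrite disjoints1 inE; apply: contra ij => /eqP/enum_val_inj ->.
  - apply/negP => xy; have := degV x; rewrite d0 leqn0 cards_eq0.
    by move/eqP/setP/(_ y); rewrite !inE xy.
have V64 : 64 <= #|V|.
  by apply: leq_trans Md; have := leq_mul M16 d_gt0; clear; lia.
pose T := [set y | [exists x, e x y]].
have [big_T|small_T] := leqP #|V| (2 * #|T|).
  right; exists setT, T, d; split=> [|y|x _|x _|].
  - by rewrite -card_gt0; clear - V2 big_T; lia.
  - by rewrite inE => /existsP[x xy]; exists x.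
  - by exists [::].
  - exact: leq_trans (fdegS x (subsetT T)) (degV x).
  - have : #|V| * (4 * M * d) <= #|V| * #|V| by rewrite leq_mul2l Md orbT.
    have : #|V| * #|V| <= (2 * #|T|) * (2 * #|T|) by apply: leq_mul.
    by clear; lia.
left; have cT := cardsC T.
have fT : {in ~: T &, forall x y, e x y -> x = y}.
  move=> x y _; rewrite !inE negb_exists => /forallP /(_ x) /negP nxy xy.
  by case: nxy.
apply: (large_classes_separated (D := 1) (f := id) _ _ fT) => //.
- exact: ltnW.
- move=> x _; rewrite -(cards1 x); apply: subset_leq_card.
  by apply/subsetP=> y; rewrite !inE => /andP[].
- have cC : #|V| <= 2 * #|~: T| by clear - cT small_T; lia.
  have : #|V| * #|V| <= (2 * #|~: T|) * (2 * #|~: T|) by apply: leq_mul.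
  have : 64 * #|V| <= #|V| * #|V| by apply: leq_mul.
  by clear; lia.
Qed.

End Separation.

(** The cost [b] of a step is uniform in the graph and the stage, so that the final constants depend
    on [k] only. *)
Lemma stage_step : exists2 b, 16 <= b &
  forall (V : finType) (e : rel V) l M, #|V| <= M ->
    stage e l (b * M) -> separated e #|V| \/ stage e l.+1 M.
Proof.
have [Q hQ Q1] : exists2 Q, 2 ^ 17 <= Q & 1 <= Q.
  by exists (2 ^ 17) => //; rewrite expn_gt0.
exists (8 * (1024 * Q ^ 2)) => [|V e l M VM].
  have : 1 <= Q ^ 2 by rewrite expn_gt0 Q1.
  by clear; lia.
by rewrite -(mulnA 8) => /stage_comb; apply: comb_stage.
Qed.

(** * Induced monotone paths in ordered graphs *)

Section OrderedGraph.
Variable G : ordered_graph.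

Definition forward : rel G := fun x y => (x < y)%O && adj x y.

(** [ipath] excludes forward edges only; since the list descends in the order, this yields
    non-adjacency. *)
Lemma ipath_nth (x0 : G) (s : seq G) i j :
  ipath forward s -> i < j < size s ->
  (nth x0 s j < nth x0 s i)%O /\
  adj (nth x0 s j) (nth x0 s i) = (j == i.+1).
Proof.
elim: s i j => [|x s IH] [|i] [|j] //=; rewrite ?ltn0 ?andbF //; last first.
  by case/andP=> _ ps; rewrite !ltnS eqSS; apply: IH.
rewrite ltnS /= eqSS; case: s IH => [|y r] //= IH.
case/andP=> /andP[/andP[yx adj_yx] /allP nr] pr jr.
case: j jr => [|j] jr; first by rewrite yx adj_yx.
have [zy _] := IH 0 j.+1 pr jr; have zx := lt_trans zy yx; split=> //.
by have := nr _ (mem_nth x0 jr); rewrite /forward /= zx => /negPf.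
Qed.

Lemma ipath_monotone_path (s : seq G) k :
  ipath forward s -> k <= size s ->
  induced_ordered_subgraph (monotone_path k) G.
Proof.
case: k => [|k] ps ks.
  by exists (fun i : 'I_0 => match (notF (ltn_ord i)) with end); split=> -[].
have x0 : G by case: s {ps} ks => [|x].
(* The list is read backwards; its first [k.+1] entries are the top of the path. *)
pose f (i : 'I_k.+1) := nth x0 s (k - i).
have f_lt (i j : 'I_k.+1) : i < j ->
    (f i < f j)%O /\ adj (f i) (f j) = (j == i.+1 :> nat).
  move=> ij; have [|ltf ->] := @ipath_nth x0 s (k - j) (k - i) ps.
    by have := ltn_ord j; lia.
  by split=> //; apply/eqP/eqP; have := ltn_ord j; lia.
exists f; split=> [i j fij|i j|i j].
- apply/val_inj; case: (ltngtP i j) => // /f_lt[]; by rewrite fij ltxx.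
- rewrite leEord leq_eqVlt => /orP[/eqP/val_inj-> //|/f_lt[/ltW]//].
- rewrite /= /mpath_adj; case: (ltngtP i j) => [ij|ji|/val_inj->].
  + by have [_ ->] := f_lt _ _ ij; lia.
  + by have [_] := f_lt _ _ ji; rewrite adj_sym => ->; lia.
  + by rewrite adj_irr; lia.
Qed.

Lemma forward_adj (x y : G) :
  ~~ forward x y -> ~~ forward y x -> ~~ adj x y.
Proof.
rewrite /forward [adj y x]adj_sym; by case: ltgtP => //= ->; rewrite adj_irr.
Qed.

End OrderedGraph.

(** * Choice of constants and conclusion *)

Lemma sparse_graph_separated (k : nat) : 0 < k ->
  exists2 c, 0 < c & forall G : ordered_graph,
    2 <= #|G| -> c * max_deg G <= #|G| ->
    ~ induced_ordered_subgraph (monotone_path k) G ->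
    separated (@forward G) #|G|.
Proof.
move=> k0; have [b b16 step] := stage_step.
have b0 : 0 < b by apply: leq_trans b16.
(* [b ^ k] pays for [k] extensions, the factor 4 for the initial stage. *)
exists (4 * b ^ k) => [|G G2 cG noP]; first by rewrite muln_gt0 expn_gt0 b0.
have degG (x : G) : fdeg (@forward G) x setT <= max_deg G.
  apply: leq_trans (leq_bigmax x); apply: subset_leq_card.
  by apply/subsetP=> y; rewrite !inE => /and3P[].
have bk : 16 <= b ^ k by apply: leq_trans b16 _; rewrite -{1}(expn1 b) leq_pexp2l.
have [//|init] := stage_init bk G2 degG cG.
have [//|[A [T [D [/set0Pn[y yT] TA rA _ _]]]]] :=
  stage_iter (@step _ _) b0 init.
(* A target exists, hence a source; its path has at least [k + 1] vertices. *)
have [x xA _] := TA y yT; have [s [ks ps _]] := rA x xA.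
by case: noP; apply: ipath_monotone_path ps _; apply: leq_trans ks; rewrite leq_addl.
Qed.

Local Open Scope ring_scope.

Theorem theorem4 (R : realType) (k : nat) (hk : (0 < k)%N) :
  exists eps alpha : R,
    [/\ 0 < eps, 0 < alpha
      & forall (G : ordered_graph) (n : nat),
          #|G| = n ->
          (2 <= n)%N ->
          (max_deg G)%:R <= eps * n%:R ->
          ~ induced_ordered_subgraph (monotone_path k) G ->
          exists (t : nat) (X : 'I_t -> {set G}),
            [/\ (2 <= t)%N,
                forall i : 'I_t, X i != set0,
                forall i j : 'I_t, i != j -> [disjoint X i & X j],
                forall i : 'I_t,
                  alpha * Num.sqrt (n%:R / #|X i|%:R) <= t%:R
              & forall i j : 'I_t, (i < j)%N -> no_edge_between (X i) (X j)]].
Proof.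
have [c c0 sep] := sparse_graph_separated hk.
exists c%:R^-1, 1; split=> [||G n Gn n2 degG noP].
- by rewrite invr_gt0 ltr0n.
- exact: ltr01.
have [||//|t [X [t2 tX dX eX]]] := sep G; first by rewrite Gn.
  by rewrite Gn -(ler_nat R) natrM mulrC -ler_pdivlMr ?ltr0n // mulrC.
(* An empty [X i] would force [n = 0]. *)
have X0 i : (0 < #|X i|)%N by have := tX i; rewrite Gn; case: #|X i| => //; lia.
exists t, X; split=> // [i|i|i j ij x y xX yX].
- by rewrite -card_gt0.
- rewrite mul1r -[leRHS]ger0_norm // -sqrtr_sqr ler_wsqrtr //.
  by rewrite ler_pdivrMr ?ltr0n // -natrX -natrM ler_nat -Gn.
- have neq : i != j by rewrite -val_eqE neq_ltn ij.
  (* Non-adjacency needs both orientations of the pair. *)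
  apply: forward_adj; first exact: eX neq _ _ xX yX.
  by apply: (eX j i) => //; rewrite eq_sym.
Qed.
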